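(* In both the commutative case (the variables $z_i$ commute) and the noncommutative case (the $z_i$ are noncommutative free variables), the following holds: for any fixed $\alpha\ge2$ and any non-zero $P\in\mathcal N\mathrm{Sym}$, there exist $n\ge1$ (the number of the free variables $z_i$) and $F_t(z)\in\mathbb A_t^{[\alpha]}\langle\langle z\rangle\rangle$, $z=(z_1,\dots,z_n)$, such that $\mathcal S_{F_t}(P)\ne0$.
   Context: $K$ is a unital commutative $\mathbb Q$-algebra, $z=(z_1,\dots,z_n)$ are independent variables, either commutative or noncommutative (free); the same notation is used for both cases. $t$ is a formal parameter commuting with everything. $K\langle\langle z\rangle\rangle$ and $K[[t]]\langle\langle z\rangle\rangle$ are the formal power series algebras in $z$ over $K$ and $K[[t]]$. $o(u)$ is the lowest degree in $z$ of the monomials occurring in $u$ (for a vector, the minimum over its components). $\mathcal Der^{[\alpha]}\langle\langle z\rangle\rangle$ is the set of $K$-derivations of $K\langle\langle z\rangle\rangle$ that increase the degree in $z$ by at least $\alpha-1$ (i.e. those sending each $z_i$ to some $u_i$ with $o(u_i)\ge\alpha$), and $\mathcal D^{[\alpha]}\langle\langle z\rangle\rangle$ is the unital subalgebra of $\mathrm{End}_K(K\langle\langle z\rangle\rangle)$ generated by $\mathcal Der^{[\alpha]}\langle\langle z\rangle\rangle$. $\mathbb A_t^{[\alpha]}\langle\langle z\rangle\rangle$ is the group of automorphisms $F_t(z)=z-H_t(z)$ of $K[[t]]\langle\langle z\rangle\rangle$ over $K[[t]]$ with $H_t(z)\in K[[t]]\langle\langle z\rangle\rangle^{\times n}$, $o(H_t(z))\ge\alpha$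 and $H_{t=0}(z)=0$. $\mathcal N\mathrm{Sym}=K\langle\Lambda\rangle$ is the free associative $K$-algebra generated by noncommutative free variables $\Lambda_m$ ($m\ge1$). For $F_t\in\mathbb A_t^{[\alpha]}\langle\langle z\rangle\rangle$, let $\lambda_m\in\mathcal D^{[\alpha]}\langle\langle z\rangle\rangle$ ($m\ge0$, $\lambda_0=1$) be the unique sequence such that $\big(\sum_{m\ge0}(-1)^mt^m\lambda_m\big)u_t(z)=u_t(F_t(z))$ for all $u_t\in K[[t]]\langle\langle z\rangle\rangle$ (operators on $K\langle\langle z\rangle\rangle$ being extended $K[[t]]$-linearly, coefficientwise in $t$). The differential operator specialization $\mathcal S_{F_t}:\mathcal N\mathrm{Sym}\to\mathcal D^{[\alpha]}\langle\langle z\rangle\rangle$ is the unique $K$-algebra homomorphism with $\mathcal S_{F_t}(\Lambda_m)=\lambda_m$ for all $m\ge1$. *)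

(* Defs.v *)
From HB Require Import structures.
From mathcomp Require Import all_boot all_algebra.
From mathcomp Require Import finmap zify boolp monalg.

Set Implicit Arguments.
Unset Strict Implicit.
Unset Printing Implicit Defensive.

Import GRing.Theory.
Local Open Scope ring_scope.

(* Monomials in n variables z_1, ..., z_n, commuting or not: a monoid M        *)
(* generated by mvar i = z_i.  letters m spells m as a product of variables;   *)
(* letters is multiplicative up to permutation, so that M lies between the     *)
(* free monoid and the free commutative monoid on n letters.  The two cases of *)
(* interest are {fmonom 'I_n} (words: free z_i) and {cmonom 'I_n}              *)
(* (multi-indices: commuting z_i); nat, in one variable, is used for powers of *)
(* the formal parameter t.                                                     *)
HB.mixin Record MonomialDef_isMonomIn (n : nat) M of MonomialDef M := {
  mvar : 'I_n -> M;
  letters : M -> seq 'I_n;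
  lettersK : forall m : M, \big[mmul/mone]_(i <- letters m) mvar i = m;
  letters_var : forall i, letters (mvar i) = [:: i];
  lettersM : forall a b : M,
    perm_eq (letters (mmul a b)) (letters a ++ letters b)
}.

#[short(type="monomInType")]
HB.structure Definition MonomIn (n : nat) :=
  { M of MonomialDef M & MonomialDef_isMonomIn n M }.

#[short(type="conomInType")]
HB.structure Definition ConomIn (n : nat) :=
  { M of ConomialDef M & MonomialDef_isMonomIn n M }.

Section FmonomIn.
Variable n : nat.

Fact fmonom_lettersK (m : {fmonom 'I_n}) :
  \big[mmul/mone]_(i <- (m : seq 'I_n)) fmu i = m.
Proof.
apply/val_inj => /=; case: m => s /=.
elim: s => [|i s IHs]; first by rewrite big_nil fm1.
by rewrite big_cons fmM IHs fmU.
Qed.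

Fact fmonom_lettersM (a b : {fmonom 'I_n}) :
  perm_eq (mmul a b : {fmonom 'I_n}) ((a : seq 'I_n) ++ b).
Proof. by rewrite fmM. Qed.

HB.instance Definition _ := MonomialDef_isMonomIn.Build n {fmonom 'I_n}
  fmonom_lettersK (@fmU 'I_n) fmonom_lettersM.
End FmonomIn.

Section CmonomIn.
Variable n : nat.

Definition cmonom_letters (m : {cmonom 'I_n}) : seq 'I_n :=
  flatten [seq nseq (m i) i | i <- enum 'I_n].

Fact count_cmonom_letters m i : count_mem i (cmonom_letters m) = m i.
Proof.
rewrite /cmonom_letters count_flatten -map_comp sumnE big_map /=.
rewrite (bigD1_seq i) ?mem_enum ?enum_uniq //= count_nseq /= eqxx mul1n.
by rewrite big1 ?addn0 // => j /negbTE neq_ji; rewrite count_nseq /= neq_ji.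
Qed.

Fact cmonom_lettersK (m : {cmonom 'I_n}) :
  \big[mmul/mone]_(i <- cmonom_letters m) ucm i = m.
Proof.
apply/eqP/cmP => i; rewrite -[RHS]count_cmonom_letters.
elim: (cmonom_letters m) => [|j s IHs]; first by rewrite big_nil cm1.
by rewrite big_cons cmM IHs cmU.
Qed.

Fact cmonom_letters_var i : cmonom_letters (ucm i) = [:: i].
Proof.
apply: perm_small_eq => //; apply/allP => j _ /=.
by rewrite count_cmonom_letters cmU addn0.
Qed.

Fact cmonom_lettersM (a b : {cmonom 'I_n}) :
  perm_eq (cmonom_letters (mmul a b)) (cmonom_letters a ++ cmonom_letters b).
Proof.
by apply/allP => i _ /=; rewrite count_cat !count_cmonom_letters cmM.
Qed.

HB.instance Definition _ := MonomialDef_isMonomIn.Build n {cmonom 'I_n}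
  cmonom_lettersK cmonom_letters_var cmonom_lettersM.
End CmonomIn.

Section NatMonom.

Fact addn_eq0_conj (a b : nat) : (a + b = 0 -> a = 0 /\ b = 0)%N.
Proof. by case: a b => [|a] []. Qed.

HB.instance Definition _ := Choice_isMonomialDef.Build nat
  addnA add0n addn0 addn_eq0_conj.
HB.instance Definition _ := MonomialDef_isConomialDef.Build nat addnC.

Fact nat_lettersK (k : nat) :
  \big[mmul/mone]_(i <- nseq k (ord0 : 'I_1)) (fun=> 1%N) i = k.
Proof. by elim: k => [|k IHk]; rewrite ?big_nil //= big_cons IHk. Qed.

Fact nat_letters_var (i : 'I_1) : nseq 1%N (ord0 : 'I_1) = [:: i].
Proof. by rewrite (ord1 i). Qed.

Fact nat_lettersM (a b : nat) : perm_eq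
  (nseq (mmul a b) (ord0 : 'I_1)) (nseq a (ord0 : 'I_1) ++ nseq b ord0).
Proof. by rewrite -nseqD. Qed.

HB.instance Definition _ := MonomialDef_isMonomIn.Build 1%N nat
  nat_lettersK nat_letters_var nat_lettersM.
End NatMonom.

Section MonomInTheory.
Variables (n : nat) (M : monomInType n).
Implicit Types (m : M).

Definition deg m : nat := size (letters m).

Definition words_upto (d : nat) : seq (seq 'I_n) :=
  flatten [seq [seq val w | w <- enum {: k.-tuple 'I_n}] | k <- iota 0 d.+1].

Definition monoms_upto (d : nat) : seq M :=
  undup [seq \big[mmul/mone]_(i <- w) mvar i | w <- words_upto d].

Lemma degM a b : deg (mmul a b) = (deg a + deg b)%N.
Proof. by rewrite /deg (perm_size (lettersM a b)) size_cat. Qed.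

Lemma deg1 : deg (mone : M) = 0%N.
Proof. by have := degM mone mone; rewrite mul1m; lia. Qed.

Lemma deg_var i : deg (mvar i : M) = 1%N.
Proof. by rewrite /deg letters_var. Qed.

Lemma deg_word (w : seq 'I_n) :
  deg (\big[mmul/mone]_(i <- w) mvar i : M) = size w.
Proof.
by elim: w => [|i w IHw]; rewrite ?big_nil ?deg1 ?big_cons ?degM ?deg_var ?IHw.
Qed.

Lemma mem_words_upto d w : (w \in words_upto d) = (size w <= d)%N.
Proof.
apply/flatten_mapP/idP => [[k]|le_wd].
  rewrite mem_iota => lt_kd /mapP[t _ ->]; rewrite size_tuple; lia.
exists (size w); first by rewrite mem_iota; lia.
by apply/mapP; exists (in_tuple w); rewrite ?mem_enum.
Qed.

Lemma mem_monoms_upto d m : (m \in monoms_upto d) = (deg m <= d)%N.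
Proof.
rewrite mem_undup; apply/mapP/idP => [[w + ->]|le_md].
  by rewrite mem_words_upto deg_word.
by exists (letters m); rewrite ?mem_words_upto ?lettersK.
Qed.

Lemma monoms_upto_uniq d : uniq (monoms_upto d).
Proof. exact: undup_uniq. Qed.

End MonomInTheory.

(* R<<M>>: the formal power series sum_m (coef f m) m over the monomials M.    *)
Record series (n : nat) (M : monomInType n) (R : Type) := Series {
  coef : M -> R
}.
Arguments Series {n M R} coef.
Arguments coef {n M R} _ _.

Section SeriesChoice.
Variables (n : nat) (M : monomInType n) (R : choiceType).
HB.instance Definition _ := [isNew for @coef n M R].
HB.instance Definition _ := [Choice of series M R by <:].
End SeriesChoice.

Lemma seriesP (n : nat) (M : monomInType n) (R : Type) (f g : series M R) :
  coef f =1 coef g -> f = g.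
Proof. by case: f g => [f] [g] /= /funext ->. Qed.

Section SeriesRing.
Variables (n : nat) (M : monomInType n) (R : nzRingType).
Implicit Types (f g h : series M R).

Definition series0 : series M R := Series (fun=> 0).
Definition seriesN f : series M R := Series (fun m => - coef f m).
Definition seriesD f g : series M R := Series (fun m => coef f m + coef g m).
Definition series1 : series M R := Series (fun m => (m == mone)%:R).
Definition seriesZ (c : R) f : series M R := Series (fun m => c * coef f m).

(* Factors of m have degree at most deg m: this is the sum over all            *)
(* factorizations m = a b.                                                     *)
Definition seriesM f g : series M R := Series (fun m =>
  \sum_(a <- monoms_upto M (deg m))
    \sum_(b <- monoms_upto M (deg m) | mmul a b == m) coef f a * coef g b).

Fact seriesDA : associative seriesD.
Proof. by move=> f g h; apply/seriesP => m /=; rewrite addrA. Qed.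
Fact seriesDC : commutative seriesD.
Proof. by move=> f g; apply/seriesP => m /=; rewrite addrC. Qed.
Fact series0D : left_id series0 seriesD.
Proof. by move=> f; apply/seriesP => m /=; rewrite add0r. Qed.
Fact seriesND : left_inverse series0 seriesN seriesD.
Proof. by move=> f; apply/seriesP => m /=; rewrite addNr. Qed.

HB.instance Definition _ := GRing.isZmodule.Build (series M R)
  seriesDA seriesDC series0D seriesND.

Lemma coef_mulw d f g m : (deg m <= d)%N ->
  coef (seriesM f g) m =
  \sum_(a <- monoms_upto M d)
    \sum_(b <- monoms_upto M d | mmul a b == m) coef f a * coef g b.
Proof.
move=> le_md /=.
have wid F : (forall a, (deg m < deg a)%N -> F a = 0) ->
    \sum_(a <- monoms_upto M (deg m)) F a = \sum_(a <- monoms_upto M d) F a :> R.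
  move=> F0; rewrite [RHS](bigID (fun a => deg a <= deg m)%N) /=.
  rewrite [X in _ = _ + X]big1 ?addr0; last first.
    by move=> a; rewrite -ltnNge => /F0.
  rewrite -[RHS]big_filter; apply: perm_big; apply: uniq_perm.
  - exact: monoms_upto_uniq.
  - by rewrite filter_uniq ?monoms_upto_uniq.
  by move=> a; rewrite mem_filter !mem_monoms_upto; lia.
rewrite wid; last first.
  by move=> a lt_ma; rewrite big1 // => b /eqP Em; move: lt_ma; rewrite -Em degM; lia.
apply: eq_bigr => a _; rewrite big_mkcond [RHS]big_mkcond; apply: wid => b lt_mb.
by case: eqP => // Em; move: lt_mb; rewrite -Em degM; lia.
Qed.

Lemma sum_monoms_pred1 d (k : M) (P : pred M) (F : M -> R) :
  (deg k <= d)%N -> P =1 pred1 k -> \sum_(e <- monoms_upto M d | P e) F e = F k.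
Proof.
move=> le_kd EP; rewrite (eq_bigl _ _ EP) -big_filter filter_pred1_uniq ?big_seq1 //.
  exact: monoms_upto_uniq.
by rewrite mem_monoms_upto.
Qed.

Lemma sum_monoms_upto1 d (k : M) (Q : pred M) (x : R) :
    (Q k -> deg k <= d)%N ->
  \sum_(e <- monoms_upto M d | Q e) (if k == e then x else 0) =
  if Q k then x else 0.
Proof.
move=> le_kd; rewrite -big_mkcondr; case: ifP => Qk; last first.
  by rewrite big1 // => e /andP[Qe /eqP ke]; rewrite ke Qe in Qk.
apply: (@sum_monoms_pred1 _ k); first exact: le_kd.
by move=> e /=; rewrite eq_sym; case: eqP => [->|]; rewrite ?Qk ?andbF.
Qed.

Fact seriesMA : associative seriesM.
Proof.
move=> f g h; apply/seriesP => m; set d := deg m.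
pose T (a b c : M) := coef f a * coef g b * coef h c.
transitivity (\sum_(a <- monoms_upto M d) \sum_(b <- monoms_upto M d)
    \sum_(c <- monoms_upto M d | mmul (mmul a b) c == m) T a b c).
  rewrite [LHS]/=; apply: eq_bigr => a _.
  transitivity (\sum_(e <- monoms_upto M d | mmul a e == m)
      \sum_(b <- monoms_upto M d) \sum_(c <- monoms_upto M d)
        if mmul b c == e then T a b c else 0).
    rewrite big_seq_cond [RHS]big_seq_cond.
    apply: eq_bigr => e /andP[]; rewrite mem_monoms_upto => le_ed _.
    rewrite -[X in _ * X = _]/(coef (seriesM g h) e) (@coef_mulw d) //.
    rewrite mulr_sumr; apply: eq_bigr => b _.
    by rewrite mulr_sumr big_mkcond; apply: eq_bigr => c _; rewrite /T mulrA.
  rewrite exchange_big; apply: eq_bigr => b _.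
  rewrite exchange_big [RHS]big_mkcond; apply: eq_bigr => c _.
  rewrite sum_monoms_upto1 ?mulmA // => /eqP Em.
  by rewrite /d -Em !degM; lia.
transitivity (\sum_(e <- monoms_upto M d)
    \sum_(c <- monoms_upto M d | mmul e c == m)
    \sum_(a <- monoms_upto M d) \sum_(b <- monoms_upto M d)
      if mmul a b == e then T a b c else 0); last first.
  rewrite [RHS]/=; apply: eq_big_seq => e; rewrite mem_monoms_upto => le_ed.
  apply: eq_bigr => c _.
  rewrite -[X in _ = X * _]/(coef (seriesM f g) e) (@coef_mulw d) //.
  rewrite mulr_suml; apply: eq_bigr => a _.
  by rewrite mulr_suml [RHS]big_mkcond.
under [RHS]eq_bigr => e _ do rewrite exchange_big.
rewrite [RHS]exchange_big; apply: eq_bigr => a _.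
under [RHS]eq_bigr => e _ do rewrite exchange_big.
rewrite [RHS]exchange_big; apply: eq_bigr => b _.
under [RHS]eq_bigr => e _ do rewrite big_mkcond.
rewrite [RHS]exchange_big [LHS]big_mkcond; apply: eq_bigr => c _ /=.
rewrite -[RHS]big_mkcond sum_monoms_upto1 // => /eqP Em.
by rewrite /d -Em !degM; lia.
Qed.

Fact series1M : left_id series1 seriesM.
Proof.
move=> f; apply/seriesP => m /=.
rewrite (bigD1_seq mone) ?monoms_upto_uniq //=; last first.
  by rewrite mem_monoms_upto deg1.
rewrite [X in _ + X]big1 ?addr0 => [|a /negbTE a1]; last first.
  by rewrite big1 // => b _; rewrite a1 mul0r.
rewrite (@sum_monoms_pred1 _ m) ?eqxx ?mul1r // => b.
by rewrite mul1m.
Qed.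

Fact seriesM1 : right_id series1 seriesM.
Proof.
move=> f; apply/seriesP => m /=.
under eq_bigr => a _ do rewrite big_mkcond.
rewrite exchange_big (bigD1_seq mone) ?monoms_upto_uniq //=; last first.
  by rewrite mem_monoms_upto deg1.
rewrite [X in _ + X]big1 ?addr0 => [|b /negbTE b1]; last first.
  by rewrite big1 // => a _; rewrite b1 mulr0 if_same.
rewrite -big_mkcond (@sum_monoms_pred1 _ m) ?eqxx ?mulr1 // => a.
by rewrite mulm1.
Qed.

Fact seriesDM : left_distributive seriesM seriesD.
Proof.
move=> f g h; apply/seriesP => m /=; rewrite -big_split; apply: eq_bigr => a _.
by rewrite -big_split; apply: eq_bigr => b _; rewrite mulrDl.
Qed.

Fact seriesMD : right_distributive seriesM seriesD.
Proof.
move=> f g h; apply/seriesP => m /=; rewrite -big_split; apply: eq_bigr => a _.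
by rewrite -big_split; apply: eq_bigr => b _; rewrite mulrDr.
Qed.

Fact series1_neq0 : series1 != series0.
Proof.
by apply/eqP => /(congr1 (fun f => coef f mone)) /= /eqP; rewrite eqxx oner_eq0.
Qed.

HB.instance Definition _ := GRing.Zmodule_isNzRing.Build (series M R)
  seriesMA series1M seriesM1 seriesDM seriesMD series1_neq0.

Fact seriesZA c d f : seriesZ c (seriesZ d f) = seriesZ (c * d) f.
Proof. by apply/seriesP => m /=; rewrite mulrA. Qed.
Fact series1Z : left_id 1 seriesZ.
Proof. by move=> f; apply/seriesP => m /=; rewrite mul1r. Qed.
Fact seriesZD : right_distributive seriesZ +%R.
Proof. by move=> c f g; apply/seriesP => m /=; rewrite mulrDr. Qed.
Fact seriesDZ f : {morph seriesZ^~ f : c d / c + d}.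
Proof. by move=> c d; apply/seriesP => m /=; rewrite mulrDl. Qed.

HB.instance Definition _ := GRing.Zmodule_isLmodule.Build R (series M R)
  seriesZA series1Z seriesZD seriesDZ.

Fact seriesZAl c f g : c *: (f * g) = (c *: f) * g.
Proof.
apply/seriesP => m /=; rewrite mulr_sumr; apply: eq_bigr => a _.
by rewrite mulr_sumr; apply: eq_bigr => b _; rewrite mulrA.
Qed.

HB.instance Definition _ :=
  GRing.Lmodule_isLalgebra.Build R (series M R) seriesZAl.

End SeriesRing.

Section SeriesComRing.
Variables (n : nat) (M : conomInType n) (R : comNzRingType).

Fact seriesMC : commutative (@seriesM n M R).
Proof.
move=> f g; apply/seriesP => m /=.
under eq_bigr => a _ do rewrite big_mkcond.
rewrite exchange_big; apply: eq_bigr => b _; rewrite [RHS]big_mkcond.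
by apply: eq_bigr => a _; rewrite mulmC mulrC.
Qed.

HB.instance Definition _ :=
  GRing.PzRing_hasCommutativeMul.Build (series M R) seriesMC.
End SeriesComRing.

Notation powser K := (series nat K).

Section PowerSeries.
Variables (n : nat) (M : monomInType n).

Definition zvar (R : nzRingType) (i : 'I_n) : series M R :=
  Series (fun m => (m == mvar i)%:R).

(* o(u) >= alpha; this holds for every alpha when u = 0.                       *)
Definition order_ge (R : nzRingType) (alpha : nat) (u : series M R) : Prop :=
  forall m : M, coef u m != 0 -> (alpha <= deg m)%N.

(* u(F) = sum_w u_w F_(w_1) ... F_(w_k), for F without constant term: the      *)
(* monomials w with deg w > deg m do not contribute to the coefficient at m.   *)
Definition subst (R : nzRingType) (F : 'I_n -> series M R) (u : series M R) :
    series M R :=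
  Series (fun m => \sum_(w <- monoms_upto M (deg m))
    coef u w * coef (\prod_(i <- letters w) F i) m).

Definition alg_automorphism (R : nzRingType) (A : lalgType R) (phi : A -> A) :
    Prop :=
  [/\ linear phi, phi 1 = 1, {morph phi : u v / u * v} & bijective phi].

Variable K : comNzRingType.

Definition derivation (D : series M K -> series M K) : Prop :=
  linear D /\ (forall u v, D (u * v) = D u * v + u * D v).

Definition Der (alpha : nat) (D : series M K -> series M K) : Prop :=
  derivation D /\ (forall i, order_ge alpha (D (zvar K i))).

(* The unital subalgebra of End_K(K<<z>>) generated by Der alpha.              *)
Inductive diffop (alpha : nat) : (series M K -> series M K) -> Prop :=
| diffop_id : diffop alpha id
| diffop_der D : Der alpha D -> diffop alpha D
| diffop_lin (c : K) f g : diffop alpha f -> diffop alpha g ->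
    diffop alpha (fun u => c *: f u + g u)
| diffop_comp f g : diffop alpha f -> diffop alpha g -> diffop alpha (f \o g).

(* The coefficient of t^k, for K[[t]]<<z>> seen as K<<z>>[[t]].                *)
Definition tcoef (k : nat) (u : series M (powser K)) : series M K :=
  Series (fun m => coef (coef u m) k).

(* (sum_j t^j L_j) u_t, where each L_j acts coefficientwise in t.              *)
Definition tseries_op (L : nat -> series M K -> series M K)
    (u : series M (powser K)) : series M (powser K) :=
  Series (fun m => Series (fun k =>
    \sum_(j < k.+1) coef (L j (tcoef (k - j) u)) m)).

(* F_t in A_t^[alpha], given by the tuple F of its components z_i - H_i.       *)
Definition in_At (alpha : nat) (F : 'I_n -> series M (powser K)) : Prop :=
  [/\ alg_automorphism (subst F),
      forall i, order_ge alpha (zvar (powser K) i - F i) &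
      forall i, tcoef 0 (zvar (powser K) i - F i) = 0].

Definition lambda_seq (alpha : nat) (F : 'I_n -> series M (powser K))
    (lam : nat -> series M K -> series M K) : Prop :=
  [/\ lam 0%N = id,
      forall m, diffop alpha (lam m) &
      forall u, tseries_op (fun m v => (-1) ^+ m *: lam m v) u = subst F u].

End PowerSeries.

Notation NSym K := {malg K[{fmonom nat}]}.

(* The free generators are indexed from 0: Lambda m is meant for m >= 1 only.  *)
Definition Lambda (K : comNzRingType) (m : nat) : NSym K :=
  << (fmu m.-1 : {fmonom nat}) >>.

Section Specialization.
Variables (K : comNzRingType) (n : nat) (M : monomInType n).

Definition dos_specialization (alpha : nat) (F : 'I_n -> series M (powser K))
    (S : NSym K -> series M K -> series M K) : Prop :=
  exists2 lam, lambda_seq alpha F lam &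
  [/\ forall p, diffop alpha (S p),
      S 1 = id,
      forall p q, S (p * q) = S p \o S q,
      forall c p q, S (c *: p + q) = (fun u => c *: S p u + S q u) &
      forall m, (1 <= m)%N -> S (Lambda K m) = lam m].

Lemma diffop_linear alpha (f : series M K -> series M K) :
  diffop alpha f -> linear f.
Proof.
elim=> [|D [[]]|c g h _ IHg _ IHh|g h _ IHg _ IHh] // d u v.
- rewrite IHg IHh !scalerDr !scalerA (mulrC c d) addrACA; congr (_ + _).
- by rewrite /= IHh IHg.
Qed.

Lemma lambda_seq_uniq alpha (F : 'I_n -> series M (powser K)) lam lam' :
  lambda_seq alpha F lam -> lambda_seq alpha F lam' -> lam = lam'.
Proof.
pose iota (u : series M K) : series M (powser K) :=
  Series (fun m => Series (fun k => if k == 0%N then coef u m else 0)).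
suff lamE l : lambda_seq alpha F l -> forall k u,
    (-1) ^+ k *: l k u = tcoef k (subst F (iota u)).
  move=> /lamE E /lamE E'; apply/funext => k; apply/funext => u.
  by apply: (can_inj (signrZK k)); rewrite E E'.
case=> _ l_do /(_ (iota _)) lE k u; rewrite -lE; apply/seriesP => m /=.
rewrite big_ord_recr /= subnn big1 ?add0r => [|j _].
  by congr (_ * coef (l k _) m); apply/seriesP.
have -> : tcoef (k - j) (iota u) = 0.
  by apply/seriesP => m' /=; rewrite subn_eq0 leqNgt ltn_ord.
have := diffop_linear (l_do j) (-1) 0 0.
by rewrite scaler0 addr0 scaleN1r addNr => ->; rewrite mulr0.
Qed.

Lemma dos_specialization_uniq alpha (F : 'I_n -> series M (powser K)) S S' :
  dos_specialization alpha F S -> dos_specialization alpha F S' -> S = S'.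
Proof.
case=> lam lamF [_ S1 SM SL Slam] [lam' lamF' [_ S'1 S'M S'L S'lam]].
have E := lambda_seq_uniq lamF' lamF; rewrite {lam' lamF'}E in S'lam.
have T0 T : (forall c (p q : NSym K),
    T (c *: p + q) = (fun u => c *: T p u + T q u)) ->
    T 0 = (fun=> 0 : series M K).
  move=> TL; have := TL (-1) 0 0; rewrite scaler0 addr0 => ->.
  by apply/funext => u; rewrite scaleN1r addNr.
apply/funext => p; rewrite (monalgE p).
elim: (enum_fset (msupp p)) => [|w r IHr]; first by rewrite !big_nil !T0.
rewrite !big_cons.
have -> : << p@_w *g w >> = p@_w *: << w >> :> NSym K.
  by rewrite -mul_malgC malgM_def fgmulUU mulr1 mul1m.
rewrite SL S'L IHr; suff -> : S << w >> = S' << w >> by [].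
case: w => s {p r IHr}; elim: s => [|j s IHs].
  have -> : << FMonom [::] >> = 1 :> NSym K by rewrite -fmoneE.
  by rewrite S1 S'1.
have -> : << FMonom (j :: s) >> = Lambda K j.+1 * << FMonom s >> :> NSym K.
  by rewrite malgM_def fgmulUU mulr1 /mmul /= fmmulE fmuE.
by rewrite SM S'M IHs Slam ?S'lam.
Qed.

End Specialization.

(* Main.v *)
Require Import Defs.
From mathcomp Require Import all_boot all_algebra.
From mathcomp Require Import finmap zify boolp monalg.

(* Fix a word w in the support of P, let s be its mirror image, of length k,  *)
(* and put a = alpha - 1.  In the variables z_0, ..., z_k, y let D_i be the   *)
(* derivation sending z_i to (-1)^(s_i) y^a z_(i+1) and all other variables   *)
(* to 0.  The automorphism exp(t^(s_0) D_0) o ... o exp(t^(s_(k-1)) D_(k-1))  *)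
(* maps z_i to z_i + (-t)^(s_i) y^a z_(i+1), and fixes y and z_k.  Its        *)
(* operators lambda_m are polynomials in the D_i, and lambda_m sends y^c z_i  *)
(* to y^(c+a) z_(i+1) if m = s_i, and to 0 otherwise (m >= 1). Hence a word v *)
(* of length l in the Lambda_m sends z_0 to y^(la) z_l if the mirror image of *)
(* v is a prefix of s, and to 0 otherwise: the coefficient of y^(ka) z_k in   *)
(* S(P)(z_0) is the coefficient of w in P.  This only uses that derivations   *)
(* with prescribed values on the variables exist, so it applies to commuting  *)
(* and to free variables alike.                                               *)

Set Implicit Arguments.
Unset Strict Implicit.
Unset Printing Implicit Defensive.

Import GRing.Theory.
Local Open Scope ring_scope.

(** [P] is a finite combination of words in the [Lambda m], so it suffices to find one automorphism
    and one coefficient of [S P] applied to a variable that retain a single word [w] of the support.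
    The automorphism turns the lambda operators into the steps of a path z_0, z_1, ..., z_k: among
    the [lam m] with m >= 1, only the one that labels step j moves y^c z_j, and the power of y
    raises the order of F to [alpha] ([exists_lambda_seq]). A word acts on z_0 by walking along the
    path, rightmost letter first, and only [w] ends at y^(ka) z_k ([word_op_zpow],
    [specialization_neq0]).

    The remaining work builds this automorphism. Linear maps that do not lower degrees are
    determined by their values on monomials ([local_linear_ext]), and the homomorphisms among them
    are substitutions ([local_hom_subst]). The commuting and the free case differ only in the proof
    of [derivations_extend]. Exponentials of derivations are multiplicative ([exp_hom]) and have two
    terms on vectors killed by the square of the derivation ([exp_square_zero]); [exp_product]
    composes them in an order in which they do not interfere. *)

Section LinearMaps.
Variables (R : nzRingType) (U V : lmodType R) (f : U -> V).
Hypothesis f_lin : linear f.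

Lemma lin0 : f 0 = 0.
Proof. by have := f_lin (-1) 0 0; rewrite scaler0 addr0 scaleN1r addNr. Qed.

Lemma linD u v : f (u + v) = f u + f v.
Proof. by have := f_lin 1 u v; rewrite !scale1r. Qed.

Lemma linN u : f (- u) = - f u.
Proof. by apply/eqP; rewrite -addr_eq0 -linD addNr lin0. Qed.

Lemma linZ c u : f (c *: u) = c *: f u.
Proof. by have := f_lin c u 0; rewrite !addr0 lin0 addr0. Qed.

Lemma lin_sum (I : Type) (r : seq I) (P : pred I) (F : I -> U) :
  f (\sum_(i <- r | P i) F i) = \sum_(i <- r | P i) f (F i).
Proof. exact: (big_morph f linD lin0). Qed.

End LinearMaps.

(** * Degree-preserving linear maps *)

Section Truncation.
Variables (n : nat) (M : monomInType n) (R : comNzRingType).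
Implicit Types (u v : series M R) (m : M) (f g : series M R -> series M R).

Definition mon m : series M R := Series (fun x => (x == m)%:R).

Definition eqd (d : nat) u v : Prop :=
  forall m, (deg m <= d)%N -> coef u m = coef v m.

(** This replaces continuity for the degree topology. Linearity over the base ring does not provide
    it, so it is carried along as a separate property. *)
Definition local f : Prop := forall d u v, eqd d u v -> eqd d (f u) (f v).

Lemma coef_series_sum (I : Type) (r : seq I) (P : pred I)
    (F : I -> series M R) m :
  coef (\sum_(i <- r | P i) F i) m = \sum_(i <- r | P i) coef (F i) m.
Proof. exact: (big_morph (fun u => coef u m)). Qed.

Lemma seriesZAr (c : R) u v : c *: (u * v) = u * (c *: v).
Proof.
apply/seriesP => m /=; rewrite mulr_sumr; apply: eq_bigr => a _.
by rewrite mulr_sumr; apply: eq_bigr => b _; rewrite mulrCA.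
Qed.

Lemma mon1 : mon mone = 1. Proof. by []. Qed.

Lemma zvarE i : zvar M R i = mon (mvar i). Proof. by []. Qed.

Lemma monM a b : mon (mmul a b) = mon a * mon b.
Proof.
apply/seriesP => m; set d := (deg m + deg a + deg b)%N.
rewrite [RHS](@coef_mulw _ _ _ d) /=; last by rewrite /d; lia.
rewrite (bigD1_seq a) ?monoms_upto_uniq ?mem_monoms_upto //=; last first.
  by rewrite /d; lia.
rewrite [X in _ + X]big1 ?addr0 => [|x /negbTE xa]; last first.
  by rewrite big1 // => y _; rewrite xa mul0r.
rewrite big_mkcond (bigD1_seq b) ?monoms_upto_uniq ?mem_monoms_upto //=;
  last by rewrite /d; lia.
rewrite [X in _ + X]big1 ?addr0 => [|y /negbTE yb]; last first.
  by rewrite yb mulr0 if_same.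
by rewrite !eqxx mulr1 eq_sym; case: eqP.
Qed.

Lemma mon_word (s : seq 'I_n) :
  mon (\big[mmul/mone]_(i <- s) mvar i) = \prod_(i <- s) zvar M R i.
Proof. exact: (big_morph mon monM mon1). Qed.

Lemma mon_letters m : mon m = \prod_(i <- letters m) zvar M R i.
Proof. by rewrite -mon_word lettersK. Qed.

Lemma eqdM d u u' v v' : eqd d u u' -> eqd d v v' -> eqd d (u * v) (u' * v').
Proof.
move=> uu vv m le_md /=; rewrite big_seq [RHS]big_seq; apply: eq_bigr => a.
rewrite mem_monoms_upto => le_am; rewrite big_seq_cond [RHS]big_seq_cond.
apply: eq_bigr => b /andP[]; rewrite mem_monoms_upto => le_bm _.
by rewrite uu ?vv //; lia.
Qed.

Lemma eqd_trunc d u :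
  eqd d u (\sum_(w <- monoms_upto M d) coef u w *: mon w).
Proof.
move=> m le_md; rewrite coef_series_sum.
rewrite (bigD1_seq m) ?monoms_upto_uniq //=; last first.
  by rewrite mem_monoms_upto.
rewrite eqxx mulr1 big1 ?addr0 // => w /negbTE wm.
by rewrite eq_sym wm mulr0.
Qed.

(** Locality allows [u] to be truncated at degree [d], which leaves a finite combination of
    monomials to which linearity applies. *)
Lemma coef_local_linear f u m d : (deg m <= d)%N -> linear f -> local f ->
  coef (f u) m = \sum_(w <- monoms_upto M d) coef u w * coef (f (mon w)) m.
Proof.
move=> le_md f_lin f_loc; rewrite (f_loc d _ _ (eqd_trunc u)) // lin_sum //.
by rewrite coef_series_sum; apply: eq_bigr => w _; rewrite linZ.
Qed.

Lemma local_linear_ext f g : linear f -> local f -> linear g -> local g ->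
  (forall m, f (mon m) = g (mon m)) -> f =1 g.
Proof.
move=> f_lin f_loc g_lin g_loc fg u; apply/seriesP => m.
rewrite (coef_local_linear _ (leqnn _)) //.
rewrite [RHS](coef_local_linear _ (leqnn _)) //.
by apply: eq_bigr => w _; rewrite fg.
Qed.

(** Multiplicativity and the Leibniz rule are equalities of bilinear maps, so this reduces both to
    pairs of monomials. *)
Lemma local_linear_ext2 (B C : series M R -> series M R -> series M R) :
    (forall v, linear (B^~ v)) -> (forall v, local (B^~ v)) ->
    (forall u, linear (B u)) -> (forall u, local (B u)) ->
    (forall v, linear (C^~ v)) -> (forall v, local (C^~ v)) ->
    (forall u, linear (C u)) -> (forall u, local (C u)) ->
  (forall a b, B (mon a) (mon b) = C (mon a) (mon b)) -> B =2 C.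
Proof.
move=> Bl1 Bc1 Bl2 Bc2 Cl1 Cc1 Cl2 Cc2 BC u v.
apply: (local_linear_ext (f := B^~ v) (g := C^~ v)) => // a.
exact: local_linear_ext.
Qed.

Lemma linear_mull u : linear ( *%R u).
Proof. by move=> c v w; rewrite mulrDr seriesZAr. Qed.

Lemma linear_mulr v : linear ( *%R^~ v).
Proof. by move=> c u w; rewrite mulrDl scalerAl. Qed.

Lemma local_mull u : local ( *%R u).
Proof. by move=> d v w vw; apply: eqdM. Qed.

Lemma local_mulr v : local ( *%R^~ v).
Proof. by move=> d u w uw; apply: eqdM. Qed.

Lemma linear_comp f g : linear f -> linear g -> linear (f \o g).
Proof. by move=> fl gl c u v /=; rewrite gl fl. Qed.

Lemma local_comp f g : local f -> local g -> local (f \o g).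
Proof. by move=> fc gc d u v /gc/fc. Qed.

Lemma linear_add f g : linear f -> linear g -> linear (f \+ g).
Proof. by move=> fl gl c u v /=; rewrite fl gl scalerDr addrACA. Qed.

Lemma local_add f g : local f -> local g -> local (f \+ g).
Proof. by move=> fc gc d u v uv m le_md /=; rewrite (fc d u v) ?(gc d u v). Qed.

Lemma linear_sum_fun (I : Type) (r : seq I)
    (F : I -> series M R -> series M R) :
  (forall i, linear (F i)) -> linear (fun u => \sum_(i <- r) F i u).
Proof.
move=> Fl c u v; rewrite scaler_sumr -big_split; apply: eq_bigr => i _.
exact: Fl.
Qed.

Lemma local_sum_fun (I : Type) (r : seq I) (F : I -> series M R -> series M R) :
  (forall i, local (F i)) -> local (fun u => \sum_(i <- r) F i u).
Proof.
move=> Fc d u v uv m le_md; rewrite !coef_series_sum; apply: eq_bigr => i _.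
exact: Fc uv _ le_md.
Qed.

Lemma linear_scale c f : linear f -> linear (fun u => c *: f u).
Proof. by move=> fl d u v; rewrite fl scalerDr !scalerA mulrC. Qed.

Lemma local_scale c f : local f -> local (fun u => c *: f u).
Proof. by move=> fc d u v uv m le_md /=; rewrite (fc d u v). Qed.

Definition local_hom f : Prop :=
  [/\ linear f, local f, f 1 = 1 & {morph f : u v / u * v}].

Lemma local_hom_id : local_hom id.
Proof. by split. Qed.

Lemma local_hom_comp f g : local_hom f -> local_hom g -> local_hom (f \o g).
Proof.
case=> fl fc f1 fM [gl gc g1 gM]; split.
- exact: linear_comp.
- exact: local_comp.
- by rewrite /= g1.
by move=> u v /=; rewrite gM fM.
Qed.

Lemma local_hom_prod f (I : Type) (r : seq I) (F : I -> series M R) :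
  local_hom f -> f (\prod_(i <- r) F i) = \prod_(i <- r) f (F i).
Proof. by case=> _ _ f1 fM; exact: (big_morph f fM f1). Qed.

(** This is the bridge to [in_At] and [lambda_seq], which speak of substitutions: automorphisms can
    be built as operators and recognized as [subst F] afterwards. *)
Lemma local_hom_subst f : local_hom f -> f = subst (fun i => f (zvar M R i)).
Proof.
move=> fh; have [fl fc _ _] := fh; apply/funext => u; apply/seriesP => m /=.
rewrite (coef_local_linear _ (leqnn _)) //; apply: eq_bigr => w _.
by rewrite mon_letters local_hom_prod.
Qed.

Lemma local_hom_ext f g : local_hom f -> local_hom g ->
  (forall i, f (zvar M R i) = g (zvar M R i)) -> f = g.
Proof.
move=> fh gh fg; rewrite (local_hom_subst fh) (local_hom_subst gh).
by congr subst; apply/funext.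
Qed.

Lemma local_hom_mon f : linear f -> local f -> f 1 = 1 ->
  (forall a b, f (mon a * mon b) = f (mon a) * f (mon b)) -> local_hom f.
Proof.
move=> fl fc f1 fM; split=> //.
apply: (local_linear_ext2 (B := fun u v => f (u * v))
  (C := fun u v => f u * f v)) => // x.
- exact: linear_comp (linear_mulr _).
- exact: local_comp (local_mulr _).
- exact: linear_comp (linear_mull _).
- exact: local_comp (local_mull _).
- exact: linear_comp (linear_mulr _) fl.
- exact: local_comp (local_mulr _) fc.
- exact: linear_comp (linear_mull _) fl.
- exact: local_comp (local_mull _) fc.
Qed.

End Truncation.

(** * Derivations *)

Section Order.
Variables (n : nat) (M : monomInType n) (R : comNzRingType).
Implicit Types (u v : series M R).

Lemma order_geD a u v : order_ge a u -> order_ge a v -> order_ge a (u + v).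
Proof.
move=> ua va m /=; have [um0|um _] := eqVneq (coef u m) 0; last exact: ua.
by rewrite um0 add0r => /va.
Qed.

Lemma order_geM a b u v :
  order_ge a u -> order_ge b v -> order_ge (a + b) (u * v).
Proof.
move=> ua vb m; apply: contraR; rewrite -ltnNge => lt_m; apply/eqP => /=.
rewrite big1 // => x _; rewrite big1 // => y /eqP xy.
have [ux|/ua le_ax] := eqVneq (coef u x) 0; first by rewrite ux mul0r.
have [vy|/vb le_by] := eqVneq (coef v y) 0; first by rewrite vy mulr0.
by move: lt_m; rewrite -xy degM; lia.
Qed.

Lemma order_ge_mon (m : M) : order_ge (deg m) (mon R m).
Proof. by move=> x /=; case: (x =P m) => [->|] //; rewrite eqxx. Qed.

End Order.

Section ExtendDerivation.
Variables (n : nat) (M : monomInType n) (R : comNzRingType).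
Variable d : 'I_n -> series M R.

Fixpoint word_der (s : seq 'I_n) : series M R :=
  if s is x :: s' then
    d x * (\prod_(i <- s') zvar M R i) + zvar M R x * word_der s'
  else 0.

Lemma word_der_cat s t : word_der (s ++ t) =
  word_der s * (\prod_(i <- t) zvar M R i) +
  (\prod_(i <- s) zvar M R i) * word_der t.
Proof.
elim: s => [|x s IHs] /=; first by rewrite big_nil mul0r mul1r add0r.
by rewrite IHs big_cat big_cons /= mulrDr mulrDl !mulrA addrA.
Qed.

Hypothesis d_order : forall i, order_ge 1 (d i).

(** Each Leibniz term replaces one letter by a series of order at least 1, so degrees do not drop.
    Hence the truncated sum in [extend_der] omits no contribution. *)
Lemma word_der_order s : order_ge (size s) (word_der s).
Proof.
elim: s => [|x s IHs] //=.
apply: order_geD; rewrite -add1n; apply: order_geM => //.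
  by rewrite -mon_word -{1}(@deg_word n M s); apply: order_ge_mon.
by rewrite -(@deg_var n M x); apply: order_ge_mon.
Qed.

Definition extend_der (u : series M R) : series M R := Series (fun m =>
  \sum_(w <- monoms_upto M (deg m)) coef u w * coef (word_der (letters w)) m).

Lemma extend_der_linear : linear extend_der.
Proof.
move=> c u v; apply/seriesP => m /=; rewrite mulr_sumr -big_split.
by apply: eq_bigr => w _ /=; rewrite mulrDl mulrA.
Qed.

Lemma extend_der_local : local extend_der.
Proof.
move=> e u v uv m le_me /=; rewrite big_seq [RHS]big_seq; apply: eq_bigr => w.
by rewrite mem_monoms_upto => le_wm; rewrite uv //; lia.
Qed.

Lemma extend_der_mon a : extend_der (mon R a) = word_der (letters a).
Proof.
apply/seriesP => m /=.
have zero w : w != a -> coef (mon R a) w * coef (word_der (letters w)) m = 0.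
  by move=> /negbTE wa; rewrite /= wa mul0r.
have [le_am|lt_ma] := leqP (deg a) (deg m).
  rewrite (bigD1_seq a) ?monoms_upto_uniq ?mem_monoms_upto //=.
  by rewrite eqxx mul1r big1 ?addr0.
(* When [deg m < deg a], the sum does not reach [a]; the expected coefficient vanishes too, by
   [word_der_order]. *)
rewrite big_seq big1 => [|w]; last first.
  rewrite mem_monoms_upto => le_wm.
  by apply: zero; apply: contraTneq le_wm => ->; lia.
apply/eqP; rewrite eq_sym; apply/contraTT: lt_ma => /word_der_order.
by rewrite /deg; lia.
Qed.

Lemma extend_der_zvar i : extend_der (zvar M R i) = d i.
Proof.
by rewrite zvarE extend_der_mon letters_var /= big_nil mulr1 mulr0 addr0.
Qed.

(** The hypothesis expresses that the Leibniz expansion ignores the reordering of letters that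
    [mmul] may cause. It is an identity for words and [word_der_perm] for commuting variables. *)
Lemma extend_derM :
    (forall a b : M,
      word_der (letters (mmul a b)) = word_der (letters a ++ letters b)) ->
  forall u v, extend_der (u * v) = extend_der u * v + u * extend_der v.
Proof.
move=> der_letters.
have Dl := extend_der_linear; have Dc := extend_der_local.
apply: (local_linear_ext2 (B := fun u v => extend_der (u * v))
  (C := fun u v => extend_der u * v + u * extend_der v))
  => [v|v|u|u|v|v|u|u|a b].
- exact: linear_comp (linear_mulr _).
- exact: local_comp (local_mulr _).
- exact: linear_comp (linear_mull _).
- exact: local_comp (local_mull _).
- apply: linear_add; last exact: linear_mulr.
  exact: linear_comp (linear_mulr v) Dl.
- by apply: local_add; [apply: local_comp (local_mulr v) Dc|apply: local_mulr].
- apply: linear_add; first exact: linear_mull.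
  exact: linear_comp (linear_mull u) Dl.
- by apply: local_add; [apply: local_mull|apply: local_comp (local_mull u) Dc].
by rewrite -monM !extend_der_mon der_letters word_der_cat -!mon_letters.
Qed.

End ExtendDerivation.

(* This fails for some M: if z_1 commutes with z_2 but not every d z_1 does,  *)
(* then the Leibniz rule is inconsistent with z_1 z_2 = z_2 z_1.              *)
Definition derivations_extend (n : nat) (M : monomInType n)
    (R : comNzRingType) :=
  forall d : 'I_n -> series M R, (forall i, order_ge 1 (d i)) ->
  exists D, [/\ derivation D, local D & forall i, D (zvar M R i) = d i].

Lemma fmonom_derivations_extend n (R : comNzRingType) :
  derivations_extend {fmonom 'I_n} R.
Proof.
move=> d d1; exists (extend_der d); split; last exact: extend_der_zvar.
  split; first exact: extend_der_linear.
  by apply: extend_derM => // a b; rewrite /letters /= fmM.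
exact: extend_der_local.
Qed.

(** In a commutative ring the formula [word_der_cat] is symmetric in its two factors, so rotating a
    word does not change its derivative; a rotation brings any chosen letter to the front. *)
Lemma word_der_perm n (M : conomInType n) (R : comNzRingType)
    (d : 'I_n -> series M R) s t : perm_eq s t -> word_der d s = word_der d t.
Proof.
elim: s t => [|x s IHs] t; first by rewrite perm_sym => /perm_nilP ->.
move=> st; have /rot_to[i t' tE] : x \in t by rewrite -(perm_mem st) mem_head.
have -> : word_der d t = word_der d (x :: t').
  rewrite -tE -{1}(cat_take_drop i t) /rot !word_der_cat addrC.
  by congr (_ + _); apply: mulrC.
have st' : perm_eq s t'.
  by rewrite -(perm_cons x) -tE perm_sym perm_rot perm_sym.
by rewrite /= (IHs t') // (perm_big _ st').
Qed.

Lemma cmonom_derivations_extend n (R : comNzRingType) :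
  derivations_extend {cmonom 'I_n} R.
Proof.
move=> d d1; exists (extend_der d); split; last exact: extend_der_zvar.
  split; first exact: extend_der_linear.
  by apply: extend_derM => // a b; apply: word_der_perm; apply: lettersM.
exact: extend_der_local.
Qed.

(** * Series in t of operators *)

Lemma sum_ord_triangle (V : nmodType) k (F : nat -> nat -> V) :
  \sum_(i < k.+1) \sum_(j < (k - i).+1) F i j =
  \sum_(j < k.+1) \sum_(i < (k - j).+1) F i j.
Proof.
have wid (G : nat -> nat -> V) : \sum_(i < k.+1) \sum_(j < (k - i).+1) G i j =
    \sum_(i < k.+1) \sum_(j < k.+1 | (i + j <= k)%N) G i j.
  apply: eq_bigr => i _; rewrite (big_ord_widen k.+1 (G i)) ?ltnS ?leq_subr //.
  by apply: eq_bigl => j; have := ltn_ord i; lia.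
rewrite wid (wid (fun j i => F i j)) (exchange_big_dep predT) //=.
by apply: eq_bigr => j _; apply: eq_bigl => i; rewrite addnC.
Qed.

Section PowserCoef.
Variable K : comNzRingType.

Lemma deg_nat (k : nat) : deg k = k.
Proof. exact: size_nseq. Qed.

Lemma sum_monoms_nat (V : nmodType) k (F : nat -> V) :
  \sum_(i <- monoms_upto nat k) F i = \sum_(i < k.+1) F i.
Proof.
rewrite -(big_mkord predT) /index_iota subn0; apply: perm_big.
apply: uniq_perm; rewrite ?monoms_upto_uniq ?iota_uniq // => i.
by rewrite mem_monoms_upto deg_nat mem_iota add0n ltnS.
Qed.

Lemma coef_powserM (c d : powser K) k :
  coef (c * d) k = \sum_(i < k.+1) coef c i * coef d (k - i)%N.
Proof.
rewrite -(sum_monoms_nat k (fun i => coef c i * coef d (k - i)%N)) /= deg_nat.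
rewrite big_seq [RHS]big_seq; apply: eq_bigr => i.
rewrite mem_monoms_upto deg_nat => le_ik.
apply: (@sum_monoms_pred1 _ _ _ _ (k - i)%N (fun b => mmul i b == k)
   (fun b => coef c i * coef d b)); first by rewrite deg_nat leq_subr.
by move=> j /=; rewrite /mmul /=; apply/eqP/eqP; lia.
Qed.

End PowserCoef.

Section TSeries.
Variables (n : nat) (M : monomInType n) (K : comNzRingType).
Implicit Types (u v : series M (powser K)) (x y : series M K).
Implicit Types (L : nat -> series M K -> series M K).

Definition tmon k x : series M (powser K) :=
  Series (fun m => Series (fun j => if j == k then coef x m else 0)).

Lemma tcoefP u v : (forall k, tcoef k u = tcoef k v) -> u = v.
Proof.
move=> uv; apply/seriesP => m; apply/seriesP => k.
by have /(congr1 (fun f => coef f m)) := uv k.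
Qed.

Lemma tcoef_tmon j k x : tcoef j (tmon k x) = if j == k then x else 0.
Proof. by apply/seriesP => m /=; case: eqP. Qed.

Lemma mon_tmon m : mon (powser K) m = tmon 0 (mon K m).
Proof.
apply/seriesP => x; apply/seriesP => j /=; case: (x == m) => //=.
  by case: eqP.
by rewrite if_same.
Qed.

Lemma tcoefZ k c u :
  tcoef k (c *: u) = \sum_(i < k.+1) coef c i *: tcoef (k - i) u.
Proof.
apply/seriesP => m; rewrite coef_series_sum.
exact: coef_powserM.
Qed.

Lemma tcoefD k u v : tcoef k (u + v) = tcoef k u + tcoef k v.
Proof. exact/seriesP. Qed.

Lemma tcoefM k u v :
  tcoef k (u * v) = \sum_(i < k.+1) tcoef i u * tcoef (k - i) v.
Proof.
apply/seriesP => m; rewrite coef_series_sum [LHS]/= coef_series_sum [RHS]/=.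
rewrite [RHS]exchange_big; apply: eq_bigr => a _.
rewrite coef_series_sum [RHS]exchange_big.
by apply: eq_bigr => b _; apply: coef_powserM.
Qed.

Lemma tcoef_tseries_op L k u :
  tcoef k (tseries_op L u) = \sum_(j < k.+1) L j (tcoef (k - j) u).
Proof. by apply/seriesP => m; rewrite coef_series_sum. Qed.

Lemma tcoef_tseries_op0 L k x : (forall j, linear (L j)) ->
  tcoef k (tseries_op L (tmon 0 x)) = L k x.
Proof.
move=> Ll; rewrite tcoef_tseries_op big_ord_recr /= subnn tcoef_tmon eqxx.
rewrite big1 ?add0r // => j _; rewrite tcoef_tmon subn_eq0 leqNgt ltn_ord.
exact: lin0.
Qed.

(** Linearity is over power series in t: the coefficients of the scalar pass through each [L j], and
    the two convolutions agree after exchanging the sums. *)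
Lemma tseries_op_linear L : (forall j, linear (L j)) -> linear (tseries_op L).
Proof.
move=> Ll c u v; apply: tcoefP => k.
rewrite tcoefD tcoefZ !tcoef_tseries_op.
under eq_bigr => j _ do rewrite tcoefD linD // tcoefZ lin_sum //.
rewrite big_split; congr (_ + _); rewrite (sum_ord_triangle k
  (fun j i => L j (coef c i *: tcoef (k - j - i) u))).
apply: eq_bigr => i _; rewrite tcoef_tseries_op scaler_sumr.
by apply: eq_bigr => j _; rewrite linZ // subnAC.
Qed.

Lemma eqd_tcoef d k u v : eqd d u v -> eqd d (tcoef k u) (tcoef k v).
Proof. by move=> uv m le_md /=; rewrite uv. Qed.

Lemma tseries_op_local L : (forall j, local (L j)) -> local (tseries_op L).
Proof.
move=> Lc d u v uv m le_md; apply/seriesP => k /=; apply: eq_bigr => j _.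
exact/(Lc j d)/le_md/eqd_tcoef.
Qed.

Definition conv L L' k x := \sum_(j < k.+1) L j (L' (k - j)%N x).

(** Both sides are linear and local, so monomials suffice; these are constant in t, and there the
    coefficient of t^k is visibly the convolution. *)
Lemma tseries_op_comp L L' :
    (forall j, linear (L j)) -> (forall j, local (L j)) ->
    (forall j, linear (L' j)) -> (forall j, local (L' j)) ->
  tseries_op L \o tseries_op L' = tseries_op (conv L L').
Proof.
move=> Ll Lc L'l L'c.
have convl k : linear (conv L L' k).
  by apply: linear_sum_fun => j; apply: linear_comp.
have convc k : local (conv L L' k).
  by apply: local_sum_fun => j; apply: local_comp.
apply/funext; apply: local_linear_ext.
- by apply: linear_comp; apply: tseries_op_linear.
- by apply: local_comp; apply: tseries_op_local.
- exact: tseries_op_linear.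
- exact: tseries_op_local.
move=> m; apply: tcoefP => k; rewrite mon_tmon tcoef_tseries_op0 //= /conv.
rewrite tcoef_tseries_op; apply: eq_bigr => j _.
by rewrite tcoef_tseries_op0.
Qed.

(** The last hypothesis says that [L] is a higher derivation in the sense of Hasse and Schmidt,
    which is multiplicativity of the generating series read coefficient by coefficient. *)
Lemma tseries_op_hom L :
    (forall j, linear (L j)) -> (forall j, local (L j)) ->
    (forall j, L j 1 = if j == 0 then 1 else 0) ->
    (forall j x y, L j (x * y) = \sum_(i < j.+1) L i x * L (j - i)%N y) ->
  local_hom (tseries_op L).
Proof.
move=> Ll Lc L1 LM; apply: local_hom_mon.
- exact: tseries_op_linear.
- exact: tseries_op_local.
- rewrite -mon1 mon_tmon; apply: tcoefP => k.
  by rewrite tcoef_tseries_op0 // mon1 L1 tcoef_tmon.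
move=> a b; apply: tcoefP => k.
rewrite -monM mon_tmon tcoef_tseries_op0 // monM LM tcoefM.
apply: eq_bigr => i _.
by rewrite !mon_tmon !tcoef_tseries_op0.
Qed.

End TSeries.

(** * Closure properties of the algebra of differential operators *)

Section DiffopTheory.
Variables (n : nat) (M : monomInType n) (K : comNzRingType) (alpha : nat).
Implicit Types (f g : series M K -> series M K).

(** No constructor yields zero directly; it arises as id - id. *)
Lemma diffop0 : diffop alpha (fun=> 0 : series M K).
Proof.
have := diffop_lin (-1) (diffop_id M K alpha) (diffop_id M K alpha).
by congr diffop; apply/funext => u; rewrite scaleN1r addNr.
Qed.

Lemma diffopZ c f : diffop alpha f -> diffop alpha (fun u => c *: f u).
Proof.
move=> fd; have := diffop_lin c fd diffop0.
by congr diffop; apply/funext => u; rewrite addr0.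
Qed.

Lemma diffop_sum (I : Type) (r : seq I) (F : I -> series M K -> series M K) :
  (forall i, diffop alpha (F i)) -> diffop alpha (fun u => \sum_(i <- r) F i u).
Proof.
move=> Fd; elim: r => [|i r IHr].
  have := diffop0; by congr diffop; apply/funext => u; rewrite big_nil.
have := diffop_lin 1 (Fd i) IHr.
by congr diffop; apply/funext => u; rewrite big_cons scale1r.
Qed.

Lemma diffop_iter k f : diffop alpha f -> diffop alpha (iter k f).
Proof.
by move=> fd; elim: k => [|k IHk]; [apply: diffop_id|apply: diffop_comp fd IHk].
Qed.

End DiffopTheory.

(** * Exponentials of derivations *)

Lemma sum_dvdn_ord (V : nmodType) p q (F : nat -> V) : (0 < p)%N ->
  \sum_(i < (p * q).+1 | (p %| i)%N) F (i %/ p)%N = \sum_(i < q.+1) F i.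
Proof.
move=> p_gt0.
rewrite -(big_mkord (fun i => p %| i)%N (fun i => F (i %/ p)%N)).
rewrite -(big_mkord predT F) -big_filter.
rewrite -(big_map (fun i => i %/ p)%N predT F).
apply: perm_big; apply: uniq_perm; rewrite ?iota_uniq //.
  rewrite map_inj_in_uniq ?filter_uniq ?iota_uniq // => i j.
  rewrite !mem_filter => /andP[pi _] /andP[pj _] ij.
  by rewrite -(divnK pi) -(divnK pj) ij.
move=> j; rewrite mem_index_iota; apply/mapP/idP => [[i]|lt_jq].
  rewrite mem_filter mem_index_iota => /andP[/dvdnP[c ->] lt_i] ->.
  by rewrite mulnK //=; nia.
exists (j * p)%N; last by rewrite mulnK.
by rewrite mem_filter dvdn_mull // mem_index_iota /=; nia.
Qed.

Section Exponential.
Variables (n : nat) (M : monomInType n) (K : comAlgType rat).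
Implicit Types (x y : series M K).

Definition inv_fact (k : nat) : K := ((k`!%:R : rat)^-1)%:A.

Lemma inv_fact_bin k i : (i <= k)%N ->
  inv_fact k * 'C(k, i)%:R = inv_fact i * inv_fact (k - i).
Proof.
move=> le_ik; rewrite /inv_fact -['C(k, i)%:R]scaler_nat.
rewrite -!scalerAl !mul1r !scalerA.
congr (_%:A); have fact0 j : (j`!%:R : rat) != 0.
  by rewrite Num.Theory.pnatr_eq0 -lt0n fact_gt0.
apply: (mulfI (fact0 k)); rewrite mulrA divff // mul1r -invfM.
by apply: (canRL (mulfK _)); rewrite ?mulf_neq0 // -!natrM bin_fact.
Qed.

Lemma inv_fact0 : inv_fact 0 = 1.
Proof. by rewrite /inv_fact fact0 invr1 scale1r. Qed.

Lemma inv_fact1 : inv_fact 1 = 1.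
Proof. by rewrite /inv_fact invr1 scale1r. Qed.

Variable D : series M K -> series M K.
Hypotheses (D_der : derivation D) (D_loc : local D).

Lemma iter_derM k x y : iter k D (x * y) =
  \sum_(i < k.+1) (iter i D x * iter (k - i) D y) *+ 'C(k, i).
Proof.
have [Dl DM] := D_der; elim: k => [|k IHk]; first by rewrite big_ord1.
rewrite iterS IHk lin_sum // [RHS]big_ord_recl /= bin0 mulr1n.
under [in RHS]eq_bigr => i _ do rewrite /bump add1n binS mulrnDr subSS.
rewrite big_split /= addrA.
(* Pascal's rule has split the right-hand side; the Leibniz rule, applied to each term on the left,
   gives the same two sums up to a shift of the index. *)
transitivity (\sum_(i < k.+1)
    ((iter i D x * iter (k - i).+1 D y) *+ 'C(k, i) +
     (iter i.+1 D x * iter (k - i) D y) *+ 'C(k, i))).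
  apply: eq_bigr => i _; rewrite -mulrnDl addrC -DM.
  by elim: 'C(k, i) => [|c IHc]; rewrite ?mulr0n ?lin0 // !mulrSr linD // IHc.
rewrite big_split /=; congr (_ + _).
rewrite big_ord_recl bin0 mulr1n subn0 -iterS /=; congr (_ + _).
rewrite [RHS]big_ord_recr /= bin_small // mulr0n addr0.
apply: eq_bigr => i _; rewrite /bump add1n -!iterS.
by have -> : (k - i)%N = (k - i.+1).+1 by have := ltn_ord i; lia.
Qed.

(** These are the divided powers of [D]; the factorials are inverted in the rational algebra [K]. *)
Definition divpow k x := inv_fact k *: iter k D x.

Lemma divpowM k x y :
  divpow k (x * y) = \sum_(i < k.+1) divpow i x * divpow (k - i) y.
Proof.
rewrite /divpow iter_derM scaler_sumr; apply: eq_bigr => i _.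
rewrite -scaler_nat scalerA inv_fact_bin; last by rewrite -ltnS.
by rewrite -[RHS]scalerAl -seriesZAr scalerA.
Qed.

Lemma iter_linear k : linear (iter k D).
Proof.
by elim: k => [|k IHk] c x y //=; rewrite IHk (D_der.1).
Qed.

Lemma iter_local k : local (iter k D).
Proof. by elim: k => [|k IHk] d x y // xy; apply: D_loc; apply: IHk. Qed.

Lemma derivation1 : D 1 = 0.
Proof.
have [_ DM] := D_der; have := DM 1 1; rewrite !mulr1 mul1r.
by move/eqP; rewrite -subr_eq0 opprD addNKr oppr_eq0 => /eqP.
Qed.

Lemma iter_der_const k x : D x = 0 -> iter k.+1 D x = 0.
Proof.
by move=> Dx; elim: k => [|k IHk] //; rewrite iterS IHk (lin0 (D_der.1)).
Qed.

(* The coefficient of t^k in exp(t^p D). *)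
Definition exp_coef p k x := if (p %| k)%N then divpow (k %/ p) x else 0.

Variables (p : nat) (p_gt0 : (0 < p)%N).

Lemma exp_coef_linear k : linear (exp_coef p k).
Proof.
rewrite /exp_coef /divpow; case: (p %| k)%N => [|c x y]; last first.
  by rewrite scaler0 addr0.
by apply: linear_scale; apply: iter_linear.
Qed.

Lemma exp_coef_local k : local (exp_coef p k).
Proof.
rewrite /exp_coef /divpow; case: (p %| k)%N => //.
by apply: local_scale; apply: iter_local.
Qed.

Lemma exp_coef_const k x : D x = 0 ->
  exp_coef p k x = if k == 0%N then x else 0.
Proof.
move=> Dx; rewrite /exp_coef; case: k => [|k].
  by rewrite dvdn0 div0n /divpow inv_fact0 scale1r.
case: ifP => // /divnK; rewrite /divpow; case: (_ %/ _)%N => [|q] // _.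
by rewrite iter_der_const ?scaler0.
Qed.

(** If [p] does not divide [k], it cannot divide both [i] and [k - i], and all terms vanish.
    Otherwise only multiples of [p] contribute, and reindexing them gives [divpowM]. *)
Lemma exp_coefM k x y :
  exp_coef p k (x * y) = \sum_(i < k.+1) exp_coef p i x * exp_coef p (k - i) y.
Proof.
rewrite {1}/exp_coef; case: ifPn => [/dvdnP[q ->]|not_pk]; last first.
  rewrite big1 // => i _; rewrite /exp_coef.
  case: ifP => pi; last by rewrite mul0r.
  case: ifP => pki; last by rewrite mulr0.
  by case/negP: not_pk; rewrite -(subnK (ltn_ord i : i <= k)%N) dvdn_add.
rewrite mulnK // divpowM mulnC -(sum_dvdn_ord _
  (fun i => divpow i x * divpow (q - i) y) p_gt0) big_mkcond.
apply: eq_bigr => i _; rewrite /exp_coef.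
case: ifP => pi; last by rewrite mul0r.
by rewrite dvdn_sub ?dvdn_mulr // divnBr // mulKn.
Qed.

Lemma exp_hom : local_hom (tseries_op (exp_coef p)).
Proof.
apply: tseries_op_hom.
- exact: exp_coef_linear.
- exact: exp_coef_local.
- by move=> k; rewrite exp_coef_const ?derivation1.
- exact: exp_coefM.
Qed.

Lemma exp_const k x : D x = 0 -> tseries_op (exp_coef p) (tmon k x) = tmon k x.
Proof.
move=> Dx; apply: tcoefP => j; rewrite tcoef_tseries_op big_ord_recl subn0.
rewrite exp_coef_const ?eqxx; last first.
  by rewrite tcoef_tmon; case: ifP => // _; rewrite (lin0 (D_der.1)).
rewrite big1 ?addr0 // => i _; rewrite exp_coef_const //.
by rewrite tcoef_tmon; case: ifP => // _; rewrite (lin0 (D_der.1)).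
Qed.

(** The exponential series stops after its linear term, so only the powers t^0 and t^p occur. *)
Lemma exp_square_zero x : D (D x) = 0 ->
  tseries_op (exp_coef p) (tmon 0 x) = tmon 0 x + tmon p (D x).
Proof.
move=> DDx; apply: tcoefP => k.
rewrite tcoef_tseries_op0; last exact: exp_coef_linear.
rewrite tcoefD !tcoef_tmon /exp_coef.
case: ifP => [/dvdnP[q ->]|not_pk]; last first.
  case: eqP => [k0|_]; first by rewrite k0 dvdn0 in not_pk.
  by case: eqP => [kp|_]; [rewrite kp dvdnn in not_pk|rewrite addr0].
rewrite mulnK // /divpow; case: q => [|[|q]].
- by rewrite mul0n eqxx inv_fact0 scale1r eq_sym (gtn_eqF p_gt0) addr0.
- by rewrite mul1n eqxx (gtn_eqF p_gt0) inv_fact1 scale1r add0r.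
rewrite iterSr iter_der_const // scaler0.
have -> : (q.+2 * p == 0)%N = false by apply/negbTE/eqP; nia.
have -> : (q.+2 * p == p)%N = false by apply/negbTE/eqP; nia.
by rewrite addr0.
Qed.

End Exponential.

Section TMonTheory.
Variables (n : nat) (M : monomInType n) (K : comNzRingType).
Implicit Types (x y : series M K).

Lemma zvar_tmon i : zvar M (powser K) i = tmon 0 (zvar M K i).
Proof. exact: mon_tmon. Qed.

Lemma tmonD k x y : tmon k (x + y) = tmon k x + tmon k y.
Proof.
by apply: tcoefP => j; rewrite tcoefD !tcoef_tmon; case: ifP; rewrite ?addr0.
Qed.

Lemma tmon0 k : tmon k (0 : series M K) = 0.
Proof. by apply: tcoefP => j; rewrite tcoef_tmon if_same; apply/seriesP. Qed.

Lemma order_ge_tmon a k x : order_ge a x -> order_ge a (tmon k x).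
Proof.
move=> xa m /= xm; apply: xa; apply: contra_neq xm => xm0.
by apply/seriesP => j /=; rewrite xm0 if_same.
Qed.

End TMonTheory.

Section ExpBijective.
Variables (n : nat) (M : monomInType n) (K : comAlgType rat) (p : nat).
Hypothesis p_gt0 : (0 < p)%N.
Implicit Types D : series M K -> series M K.

(** The composite is a local homomorphism, so it is compared with the identity on variables, where
    both exponentials have two terms and the terms in t^p cancel. Relating [D'] to [D] by an
    equation lets the lemma serve for both directions in [exp_bijective]. *)
Lemma exp_opp_cancel D D' : derivation D -> local D ->
    derivation D' -> local D' -> (forall i, D (D (zvar M K i)) = 0) ->
    (forall x, D' x = - D x) ->
  cancel (tseries_op (exp_coef D p)) (tseries_op (exp_coef D' p)).
Proof.
move=> Dd Dc D'd D'c DD D'E.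
have Eh := exp_hom Dd Dc p_gt0; have E'h := exp_hom D'd D'c p_gt0.
have lin' : linear (tseries_op (exp_coef D' p)) by case: E'h.
suff : tseries_op (exp_coef D' p) \o tseries_op (exp_coef D p) = id.
  by move=> + u => /(congr1 (@^~ u)).
apply: local_hom_ext (local_hom_comp E'h Eh) (local_hom_id _ _) _ => i.
rewrite /= zvar_tmon exp_square_zero // linD // exp_square_zero //; last first.
  by rewrite !D'E linN ?DD ?oppr0 //; case: Dd.
rewrite exp_const // ?D'E ?DD ?oppr0 //.
by rewrite -addrA -tmonD addNr tmon0 addr0.
Qed.

Lemma derivation_opp D : derivation D -> derivation (fun x => - D x).
Proof.
case=> Dl DM; split=> [c x y|x y]; first by rewrite Dl opprD scalerN.
by rewrite DM opprD mulNr mulrN.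
Qed.

Lemma exp_bijective D : derivation D -> local D ->
    (forall i, D (D (zvar M K i)) = 0) ->
  bijective (tseries_op (exp_coef D p)).
Proof.
move=> Dd Dc DD; have D'd := derivation_opp Dd.
have D'c : local (fun x => - D x).
  by move=> d x y xy m le_md /=; rewrite (Dc d x y).
have DN x : D (- x) = - D x by rewrite linN //; case: Dd.
exists (tseries_op (exp_coef (fun x => - D x) p)).
  exact: exp_opp_cancel.
apply: exp_opp_cancel => // [i|x]; first by rewrite DN opprK DD.
by rewrite opprK.
Qed.

End ExpBijective.

(** * The specialization *)

Section Specialize.
Variables (n : nat) (M : monomInType n) (K : comNzRingType) (alpha : nat).
Variable F : 'I_n -> series M (powser K).
Variable lam : nat -> series M K -> series M K.
Hypothesis lamF : lambda_seq alpha F lam.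

Definition word_op (w : seq nat) : series M K -> series M K :=
  foldr (fun i f => lam i.+1 \o f) id w.

Lemma word_op_cat v w : word_op (v ++ w) = word_op v \o word_op w.
Proof. by elim: v => [|i v IHv] //=; rewrite IHv. Qed.

Lemma word_op_diffop w : diffop alpha (word_op w).
Proof.
have [_ lam_do _] := lamF.
by elim: w => [|i w IHw]; [apply: diffop_id|apply: diffop_comp].
Qed.

(** With [u] fixed, this is only a linear extension from words: [mmap] wants a ring as target, so
    scalars are sent to constant series. Multiplicativity in [p] holds for the operators, under
    composition, not for these values. *)
Definition word_ext (p : NSym K) (u : series M K) : series M K :=
  mmap (in_alg (series M K)) (fun w : {fmonom nat} => word_op w u) p.

Lemma word_extE p u : word_ext p u = \sum_(w <- msupp p) p@_w *: word_op w u.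
Proof.
by rewrite /word_ext mmapE; apply: eq_bigr => w _; rewrite mulr_algl.
Qed.

Lemma word_extU c w u : word_ext << c *g w >> u = c *: word_op w u.
Proof. by rewrite /word_ext mmapU /= mulr_algl. Qed.

Lemma word_ext_sum (I : Type) (r : seq I) (G : I -> NSym K) u :
  word_ext (\sum_(i <- r) G i) u = \sum_(i <- r) word_ext (G i) u.
Proof. exact: raddf_sum. Qed.

Lemma word_ext_specialization : dos_specialization alpha F word_ext.
Proof.
exists lam => //; split=> [p||p q|c p q|m m_gt0].
- have := diffop_sum (msupp p)
    (fun w : {fmonom nat} => diffopZ p@_w (word_op_diffop w)).
  by congr diffop; apply/funext => u; rewrite word_extE.
- by apply/funext => u; rewrite -[1]/(<< 1 *g mone >>) word_extU scale1r fm1.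
- apply/funext => u; rewrite /= [RHS]word_extE malgME word_ext_sum.
  apply: eq_bigr => v _.
  have vl := diffop_linear (word_op_diffop v).
  rewrite word_ext_sum (word_extE q) (lin_sum vl).
  rewrite scaler_sumr; apply: eq_bigr => w _.
  by rewrite word_extU fmM word_op_cat /= -scalerA (linZ vl).
- apply/funext => u; rewrite /word_ext mmapD; congr (_ + _).
  rewrite -/(word_ext (c *: p) u) -/(word_ext p u).
  rewrite malgZ_def /fgscale word_ext_sum word_extE.
  by rewrite scaler_sumr; apply: eq_bigr => w _; rewrite word_extU scalerA.
(* For [m >= 1] the successor in [word_op] undoes the predecessor in [Lambda]. *)
apply/funext => u; rewrite /Lambda word_extU scale1r fmU /=.
by rewrite prednK.
Qed.

End Specialize.

(** * The automorphism attached to a word *)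

Section Construction.
Variables (K : comAlgType rat) (a : nat) (s : seq nat).
Let n := (size s).+2.
Variable M : monomInType n.
Let k := size s.
(* The letter i of a word stands for Lambda_(i+1). *)
Let wt i := (nth 0 s i).+1.

(* y^c z_j, where y is the last of the variables z_0, ..., z_k, y. *)
Definition zpow c j : M :=
  \big[mmul/mone]_(i <- rcons (nseq c (ord_max : 'I_n)) (inord j)) mvar i.

Lemma deg_zpow c j : deg (zpow c j) = c.+1.
Proof. by rewrite deg_word size_rcons size_nseq. Qed.

Notation y := (zvar M K ord_max).
Notation z j := (zvar M K (inord j)).
Notation e c j := (mon K (zpow c j)).

Lemma mon_zpow c j : e c j = y ^+ c * z j.
Proof.
rewrite mon_word -cats1 big_cat big_seq1 /= big_nseq; congr (_ * _).
by elim: c => [|c IHc] //=; rewrite IHc exprS.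
Qed.

Lemma inord_neq i j : (i <= k.+1)%N -> (j <= k.+1)%N -> i != j ->
  (inord i : 'I_n) != inord j.
Proof.
move=> ik jk ij; apply: contra_neq ij => /(congr1 val) /=.
by rewrite !inordK.
Qed.

Lemma max_inord : (ord_max : 'I_n) = inord k.+1.
Proof. by apply/val_inj; rewrite /= inordK. Qed.

Variable D : nat -> series M K -> series M K.
Hypotheses (D_der : forall i, derivation (D i)) (D_loc : forall i, local (D i)).
Hypothesis D_zvar : forall i (x : 'I_n), D i (zvar M K x) =
  if x == inord i then (-1) ^+ wt i *: e a i.+1 else 0.

Lemma D_y i c : (i < k)%N -> D i (y ^+ c) = 0.
Proof.
move=> lt_ik; have [_ DM] := D_der i.
elim: c => [|c IHc]; first exact: derivation1.
rewrite exprS DM IHc mulr0 addr0 D_zvar max_inord.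
by rewrite (negPf (inord_neq _ _ _)) ?mul0r //; lia.
Qed.

Lemma D_zpow i c j : (i < k)%N -> (j <= k)%N ->
  D i (e c j) = if j == i then (-1) ^+ wt i *: e (c + a) i.+1 else 0.
Proof.
move=> lt_ik le_jk; have [_ DM] := D_der i.
rewrite mon_zpow DM D_y // mul0r add0r D_zvar.
have [->|ji] := eqVneq j i; last first.
  by rewrite (negPf (inord_neq _ _ ji)) ?mulr0 //; lia.
by rewrite eqxx -seriesZAr !mon_zpow mulrA -exprD.
Qed.

(** The only variable moved is z_i, and its image involves only y and z_(i+1), which are killed.
    Variables are enough, since they determine the exponential. *)
Lemma D_square i x : (i < k)%N -> D i (D i (zvar M K x)) = 0.
Proof.
move=> lt_ik; have [Dl _] := D_der i.
rewrite D_zvar; case: ifP => _; last exact: lin0.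
by rewrite linZ // D_zpow // gtn_eqF // scaler0.
Qed.

Hypothesis D_Der : forall i, Der a.+1 (D i).

(** [L] is the composite of the last [r] exponentials, and each induction step adds one on the
    outside, with a smaller index. Since D_i moves z_i only, it fixes the images of the later
    variables. In the opposite order z_(i+1) would be moved again, and the image of z_i would
    acquire further terms. *)
Lemma exp_product r : (r <= k)%N -> exists L,
  [/\ L 0 = id, forall m, diffop a.+1 (L m) /\ local (L m),
      local_hom (tseries_op L) /\ bijective (tseries_op L),
      forall c j, (j <= k)%N -> tseries_op L (tmon 0 (e c j)) =
         tmon 0 (e c j) + (if (k - r <= j < k)%N then
            tmon (wt j) ((-1) ^+ wt j *: e (c + a) j.+1) else 0) &
      tseries_op L (tmon 0 y) = tmon 0 y].
Proof.
elim: r => [_|r IHr lt_rk].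
  pose L (m : nat) (x : series M K) := if m == 0 then x else 0.
  have Ll m : linear (L m).
    by rewrite /L; case: (m == _) => // c x x'; rewrite scaler0 addr0.
  have Lc m : local (L m) by rewrite /L; case: (m == _).
  have Lid : tseries_op L = id.
    apply/funext => u; apply: tcoefP => m; rewrite tcoef_tseries_op.
    by rewrite big_ord_recl /= subn0 big1 ?addr0.
  exists L; rewrite Lid; split=> //.
  - move=> m; split=> //; rewrite /L; case: (m == _); first exact: diffop_id.
    exact: diffop0.
  - by split; [apply: local_hom_id|exists id].
  - move=> c j le_jk; case: ifP => [|_]; last by rewrite addr0.
    by rewrite subn0 => /andP[]; lia.
have [L [L0 Ldc [Lh Lb] Lz Ly]] := IHr (ltnW lt_rk).
set i := (k - r.+1)%N; have lt_ik : (i < k)%N by rewrite /i; lia.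
have wt_gt0 : (0 < wt i)%N by [].
have Eh := exp_hom (D_der i) (@D_loc i) wt_gt0.
have Eb := exp_bijective wt_gt0 (D_der i) (@D_loc i)
  (fun x => D_square x lt_ik).
have El m : linear (exp_coef (D i) (wt i) m) by apply: exp_coef_linear.
have Ec m : local (exp_coef (D i) (wt i) m) by apply: exp_coef_local.
have [Dl _] := D_der i.
have Ed m : diffop a.+1 (exp_coef (D i) (wt i) m).
  rewrite /exp_coef; case: (_ %| _)%N; last exact: diffop0.
  by apply: diffopZ; apply: diffop_iter; apply: diffop_der.
have Ll m : linear (L m) by apply: diffop_linear (Ldc m).1.
have compE := tseries_op_comp El Ec Ll (fun m => (Ldc m).2).
exists (conv (exp_coef (D i) (wt i)) L); rewrite -compE; split.
- apply/funext => x; rewrite /conv big_ord1 subnn L0 /exp_coef dvdn0 div0n.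
  by rewrite /divpow inv_fact0 scale1r.
- move=> m; split.
    by apply: diffop_sum => j; apply: diffop_comp => //; apply: (Ldc _).1.
  by apply: local_sum_fun => j; apply: local_comp => //; apply: (Ldc _).2.
- by split; [apply: local_hom_comp|apply: bij_comp].
- move=> c j le_jk; rewrite /= Lz //; have [El' _ _ _] := Eh.
  have [->|ji] := eqVneq j i.
    (* The inner composite still fixes y^c z_i, so the new exponential acts on it alone. *)
    have -> : (k - r <= i < k)%N = false by rewrite /i; lia.
    have -> : (k - r.+1 <= i < k)%N by rewrite /i; lia.
    rewrite addr0 exp_square_zero // !D_zpow ?(ltnW lt_ik) // eqxx //.
    by rewrite linZ // D_zpow // gtn_eqF // scaler0.
  (* For [j != i], z_j is killed by [D i]; when its image has a second term, [j > i], so z_(j+1) is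
     killed as well. *)
  have -> : (k - r <= j < k)%N = (k - r.+1 <= j < k)%N by rewrite /i in ji; lia.
  rewrite linD // exp_const // ?D_zpow ?(negPf ji) //; congr (_ + _).
  case: ifP => [/andP[le_ij lt_jk]|_]; last exact: lin0.
  rewrite exp_const // linZ ?D_zpow ?(D_der i).1 //.
  rewrite ifN ?scaler0 //; rewrite /i in ji *; lia.
rewrite /= Ly exp_const //; exact: (D_y 1 lt_ik).
Qed.

End Construction.

Lemma order_geZ n (M : monomInType n) (R : comNzRingType) a c (u : series M R) :
  order_ge a u -> order_ge a (c *: u).
Proof.
by move=> ua m /= cum; apply: ua; apply: contra_neq cum => ->; rewrite mulr0.
Qed.

Lemma order_ge_zpow (K : comNzRingType) s (M : monomInType (size s).+2) c j :
  order_ge c.+1 (mon K (@zpow s M c j)).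
Proof. by rewrite -(deg_zpow M c j); apply: order_ge_mon. Qed.

Section Main.
Variables (K : comAlgType rat) (a : nat) (s : seq nat).
Let n := (size s).+2.
Variable M : monomInType n.
Hypothesis M_ext : derivations_extend M K.
Let k := size s.
Let wt i := (nth 0 s i).+1.
Notation e c j := (mon K (@zpow s M c j)).

Lemma exists_automorphism : exists L : nat -> series M K -> series M K,
  [/\ L 0 = id, forall m, diffop a.+1 (L m),
      local_hom (tseries_op L) /\ bijective (tseries_op L),
      forall c j, (j <= k)%N -> tseries_op L (tmon 0 (e c j)) =
         tmon 0 (e c j) + (if (j < k)%N then
            tmon (wt j) ((-1) ^+ wt j *: e (c + a) j.+1) else 0) &
      tseries_op L (tmon 0 (zvar M K ord_max)) = tmon 0 (zvar M K ord_max)].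
Proof.
pose d i (x : 'I_n) : series M K :=
  if x == inord i then (-1) ^+ wt i *: e a i.+1 else 0.
have d_ord i x : order_ge a.+1 (d i x).
  rewrite /d; case: ifP => _; first exact/order_geZ/order_ge_zpow.
  by move=> m /=; rewrite eqxx.
have d_ext i : exists D,
    [/\ derivation D, local D & forall x, D (zvar M K x) = d i x].
  by apply: M_ext => x m /d_ord; apply: leq_ltn_trans.
have [D DP] := choice d_ext.
have D_Der i : Der a.+1 (D i).
  by have [Dd _ Dz] := DP i; split=> // x; rewrite Dz.
have [||||L [L0 Ldc Lhb Lz Ly]] := @exp_product K a s M D _ _ _ D_Der k => //.
- by move=> i; have [] := DP i.
- by move=> i; have [] := DP i.
- by move=> i; have [] := DP i.
exists L; split=> // [m|c j le_jk]; first by have [] := Ldc m.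
by rewrite Lz // subnn.
Qed.

(** The operators are read off as coefficients of t^m. The sign put into the derivations cancels the
    alternating sign in the definition of [lambda_seq], so that [lam] moves y^c z_j without a
    sign. *)
Lemma exists_lambda_seq : exists F lam,
  [/\ in_At a.+1 F, lambda_seq a.+1 F lam &
      forall m c j, (0 < m)%N -> (j <= k)%N ->
        lam m (e c j) = if (j < k)%N && (m == wt j) then e (c + a) j.+1 else 0].
Proof.
have [L [L0 Ld [Lh Lb] Lz Ly]] := exists_automorphism.
have Ll m := diffop_linear (Ld m).
pose F x := tseries_op L (zvar M (powser K) x).
have LF : tseries_op L = subst F := local_hom_subst Lh.
pose lam m x := (-1) ^+ m *: L m x : series M K.
have FE x : exists r,
    [/\ F x = zvar M (powser K) x + r, order_ge a.+1 r & tcoef 0 r = 0].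
  have r0 : order_ge a.+1 (0 : series M (powser K)).
    by move=> m /=; rewrite eqxx.
  have t0 : tcoef 0 (0 : series M (powser K)) = 0 by apply/seriesP.
  (* The last index [k.+1] belongs to y, which is fixed; every other variable is [e 0 x]. The
     remainder [r] is -H. *)
  rewrite /F zvar_tmon; have [lt_xk|ge_xk] := ltnP x k.+1; last first.
    have -> : x = ord_max.
      apply/val_inj => /=; have := ltn_ord x.
      by rewrite /n /k in ge_xk *; lia.
    by exists 0; rewrite Ly addr0.
  have -> : zvar M K x = e 0 x by rewrite /zpow /= big_seq1 inord_val.
  rewrite Lz //; eexists; split; first by [].
    case: (x < k)%N => //; exact/order_ge_tmon/order_geZ/order_ge_zpow.
  by case: (x < k)%N => //; rewrite tcoef_tmon.
exists F, lam; split.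
- split=> [|x|x].
  + rewrite -LF; case: Lh => ? _ ? ?; split=> //.
  + have [r [-> ro _]] := FE x; rewrite opprD addNKr -scaleN1r.
    exact: order_geZ.
  have [r [-> _ r0]] := FE x; rewrite opprD addNKr.
  apply/seriesP => m /=; move/(congr1 (fun f => coef f m)): r0 => /= ->.
  by rewrite oppr0.
- split=> [|m|u].
  + by apply/funext => x; rewrite /lam L0 scale1r.
  + exact: diffopZ.
  rewrite -LF; congr tseries_op; apply/funext => m; apply/funext => x.
  by rewrite /lam signrZK.
move=> m c j m_gt0 le_jk.
rewrite /lam -(tcoef_tseries_op0 _ _ Ll) Lz // tcoefD tcoef_tmon.
rewrite (gtn_eqF m_gt0) add0r; case: ifP => _ /=; last first.
  by apply/seriesP => x /=; rewrite mulr0.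
rewrite tcoef_tmon; case: eqP => [->|_]; last by rewrite scaler0.
by rewrite signrZK.
Qed.

End Main.

(** * Detecting the coefficient of a word *)

(** The rightmost letter acts first, whence the reversal. Each letter that matches the next entry of
    [s] advances z_j by one and multiplies by y^a; a mismatch, or a step beyond the end of [s],
    gives 0. *)
Lemma word_op_zpow (K : comAlgType rat) a s (M : monomInType (size s).+2) lam
    (w : seq nat) :
    (forall m c j, (0 < m)%N -> (j <= size s)%N ->
      lam m (mon K (@zpow s M c j)) = if (j < size s)%N && (m == (nth 0 s j).+1)
        then mon K (zpow M (c + a) j.+1) else 0) ->
    (forall m, lam m 0 = 0) ->
  word_op lam w (mon K (@zpow s M 0 0)) =
  if prefix (rev w) s then mon K (zpow M (size w * a) (size w)) else 0.
Proof.
move=> lamE lam0; elim: w => [|i w IHw] /=; first by rewrite prefix0s mul0n.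
rewrite IHw rev_cons; case: ifPn => [ws|not_ws]; last first.
  rewrite lam0 ifN //; apply: contraNN not_ws; apply: prefix_trans.
  exact: prefix_rcons.
have le_ws : (size w <= size s)%N by rewrite -(size_rev w) size_prefix.
rewrite lamE // addnC -mulSn; congr (if _ then _ else _).
rewrite [RHS]prefixE size_rcons size_rev.
move: ws; rewrite prefixE size_rev => /eqP ws.
(* Either a next entry of [s] exists and must equal the new letter, or [s] is exhausted and no
   longer word is a prefix of it. *)
case: ltnP => [lt_ws|le_sw] /=.
  by rewrite (take_nth 0 lt_ws) ws eqseq_rcons eqxx eqSS eq_sym.
apply/esym/negbTE; rewrite take_oversize ?(leqW le_sw) //.
by apply: contraL le_sw => /eqP ->; rewrite size_rcons size_rev ltnn.
Qed.

(** With s = [rev w], the words surviving on z_0 are those whose mirror image is a prefix of s, and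
    their final monomials are separated by degree. The coefficient at the monomial reached by [w] is
    therefore that of [w] in [P]. *)
Lemma specialization_neq0 (K : comAlgType rat) a (w : seq nat) (P : NSym K)
    (M : monomInType (size (rev w)).+2) :
    (0 < a)%N -> derivations_extend M K -> P@_(FMonom w) != 0 ->
  exists F : 'I_(size (rev w)).+2 -> series M (powser K), in_At a.+1 F /\
    exists2 S, dos_specialization a.+1 F S & S P <> (fun=> 0).
Proof.
move=> a_gt0 M_ext Pw.
have [F [lam [FA lamF lamE]]] := exists_lambda_seq a M_ext.
exists F; split=> //; exists (word_ext lam).
  exact: word_ext_specialization.
move=> SP0; case/eqP: (Pw).
have lam0 m : lam m 0 = 0 by case: lamF => _ /(_ m)/diffop_linear/lin0.
have := congr1 (fun f =>
  coef (f (mon K (zpow M 0 0))) (zpow M (size w * a) (size w))) SP0.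
rewrite /= word_extE coef_series_sum => <-.
have termE (v : {fmonom nat}) :
    coef (P@_v *: word_op lam v (mon K (zpow M 0 0)))
    (zpow M (size w * a) (size w)) = if v == FMonom w then P@_v else 0.
  rewrite /= (word_op_zpow _ lamE lam0).
  have [->|vw] := eqVneq v (FMonom w).
    by rewrite prefix_refl /= eqxx mulr1.
  case: ifP => [vs|_] /=; last by rewrite mulr0.
  (* Comparing the degrees [(size v * a).+1] and [(size w * a).+1], with [0 < a], gives words of
     equal length; a prefix of full length is the whole word. *)
  case: eqP => [/(congr1 (@deg _ _))|]; last by rewrite mulr0.
  rewrite !deg_zpow => -[/eqP]; rewrite eqn_pmul2r // => /eqP size_vw.
  case/negP: vw; apply/eqP/val_inj/(can_inj revK) => /=.
  move: vs; rewrite prefixE size_rev -size_vw -(size_rev w) take_size => /eqP.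
  by move=> ->.
under eq_bigr => v _ do rewrite termE.
rewrite -big_mkcond /= -big_filter filter_pred1_uniq ?big_seq1 //.
  exact: fset_uniq.
by rewrite -mcoeff_neq0.
Qed.

Theorem theorem4p5 (K : comAlgType rat) (alpha : nat) (alpha_ge2 : (2 <= alpha)%N)
    (P : NSym K) (P_neq0 : P != 0) :
  (* commuting variables *)
  (exists n : nat, (1 <= n)%N /\
     exists F : 'I_n -> series {cmonom 'I_n} (powser K), in_At alpha F /\
       exists2 S : NSym K -> series {cmonom 'I_n} K -> series {cmonom 'I_n} K,
         dos_specialization alpha F S & S P <> (fun=> 0)) /\
  (* noncommutative free variables *)
  (exists n : nat, (1 <= n)%N /\
     exists F : 'I_n -> series {fmonom 'I_n} (powser K), in_At alpha F /\
       exists2 S : NSym K -> series {fmonom 'I_n} K -> series {fmonom 'I_n} K,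
         dos_specialization alpha F S & S P <> (fun=> 0)).
Proof.
have [w Pw] : exists w : seq nat, P@_(FMonom w) != 0.
  move: P_neq0; rewrite -msupp_eq0 => /fset0Pn[w].
  by rewrite -mcoeff_neq0 -(fmK w); exists w.
case: alpha alpha_ge2 => // a a_gt0.
(* The variables are z_0, ..., z_k with k the length of [w], together with y. *)
split; exists (size (rev w)).+2; split=> //.
  exact: (specialization_neq0 a_gt0 (@cmonom_derivations_extend _ _) Pw).
exact: (specialization_neq0 a_gt0 (@fmonom_derivations_extend _ _) Pw).
Qed.
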